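(* There is a linear isometric embedding of $\left(\bigoplus_{2^{\omega}}\ell_\infty\right)_{\ell_1}$ into $\ell_\infty$.
   Context: $2^\omega$ is the cardinality of the continuum. $\left(\bigoplus_{2^{\omega}}\ell_\infty\right)_{\ell_1}$ is the $\ell_1$-sum of $2^\omega$ many copies of $\ell_\infty=\ell_\infty(\mathbb N)$, i.e. families $(x_t)_{t\in 2^\omega}$ in $\ell_\infty$ with norm $\sum_t\|x_t\|_{\ell_\infty}<\infty$. *)

(* Defs.v *)
From HB Require Import structures.
From mathcomp Require Import all_boot all_order all_algebra.
From mathcomp Require Import all_classical all_reals all_analysis.

Set Implicit Arguments.
Unset Strict Implicit.
Unset Printing Implicit Defensive.

Import Order.TTheory GRing.Theory Num.Theory.
Import numFieldNormedType.Exports.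

Local Open Scope classical_set_scope.
Local Open Scope ring_scope.

Section ell_infty.
Variable R : realType.

Definition bounded_seq : {pred nat -> R} := fun u => `[< bounded_fun u >].

Lemma bounded_seqP (u : nat -> R) :
  reflect (exists M, forall n, `|u n| <= M) (u \in bounded_seq).
Proof.
apply: (iffP (asboolP _)) => [[M [_ uM]]|[M uM]].
- by exists (M + 1) => n; apply: uM => //; rewrite ltrDl.
- exists M; split; first exact: num_real.
  by move=> N MN n _; exact: le_trans (uM n) (ltW MN).
Qed.

Lemma bounded_seq_submod_closed : submod_closed bounded_seq.
Proof.
split; first by apply/bounded_seqP; exists 0 => n; rewrite normr0.
move=> a u v /bounded_seqP[M uM] /bounded_seqP[N vN].
apply/bounded_seqP; exists (`|a| * M + N) => n.
by rewrite (le_trans (ler_normD _ _))// lerD// normrM ler_wpM2l.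
Qed.

HB.instance Definition _ := GRing.isSubmodClosed.Build R (nat -> R) bounded_seq
  bounded_seq_submod_closed.

(* Real scalars; addition and scaling are pointwise, inherited from nat -> R. *)
Record ell_infty := EllInfty {
  ell_infty_seq :> nat -> R;
  ell_inftyP : ell_infty_seq \in bounded_seq }.

HB.instance Definition _ := [isSub for ell_infty_seq].
HB.instance Definition _ := [Choice of ell_infty by <:].
HB.instance Definition _ := [SubChoice_isSubLmodule of ell_infty by <:].

Definition ell_infty_norm (x : ell_infty) : R := sup (range (fun n => `|x n|)).

Lemma ell_infty_norm_ubound (x : ell_infty) n : `|x n| <= ell_infty_norm x.
Proof.
have /bounded_seqP[M xM] := ell_inftyP x.
by apply: ub_le_sup; [exists M => _ [m _ <-] | exists n].
Qed.

Lemma ell_infty_norm_le (x : ell_infty) (M : R) :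
  (forall n, `|x n| <= M) -> ell_infty_norm x <= M.
Proof.
move=> xM; apply: ge_sup; first by exists `|x 0%N|, 0%N.
by move=> _ [n _ <-].
Qed.

Lemma ler_ell_infty_normD (x y : ell_infty) :
  ell_infty_norm (x + y) <= ell_infty_norm x + ell_infty_norm y.
Proof.
apply: ell_infty_norm_le => n; rewrite (le_trans (ler_normD _ _))//.
by rewrite lerD// ell_infty_norm_ubound.
Qed.

Lemma ell_infty_normZ (a : R) (x : ell_infty) :
  ell_infty_norm (a *: x) = `|a| * ell_infty_norm x.
Proof.
apply/eqP; rewrite eq_le; apply/andP; split.
  apply: ell_infty_norm_le => n.
  by rewrite normrM ler_wpM2l// ell_infty_norm_ubound.
have [->|a0] := eqVneq a 0.
  rewrite normr0 mul0r (le_trans _ (ell_infty_norm_ubound _ 0))//.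
rewrite mulrC -ler_pdivlMr ?normr_gt0//; apply: ell_infty_norm_le => n.
rewrite ler_pdivlMr ?normr_gt0// mulrC -normrM.
exact: (ell_infty_norm_ubound (a *: x)).
Qed.

Lemma ell_infty_norm0_eq0 (x : ell_infty) : ell_infty_norm x = 0 -> x = 0.
Proof.
move=> x0; apply/val_inj/funext => n; apply/eqP.
by rewrite -normr_le0 -x0 ell_infty_norm_ubound.
Qed.

HB.instance Definition _ := Lmodule_isNormed.Build R ell_infty
  ler_ell_infty_normD ell_infty_normZ ell_infty_norm0_eq0.

Lemma ell_infty_normE (x : ell_infty) :
  `|x| = sup (range (fun n => `|x n|)).
Proof. by []. Qed.

End ell_infty.

Section ell1_sum.
Variables (R : realType) (I : choiceType) (V : normedModType R).

Local Notation nsum x := (\esum_(i in [set: I]) `|x i|%:E)%E.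

Definition norm_summable : {pred I -> V} := fun x => (nsum x < +oo)%E.

Lemma nsum_ge0 (x : I -> V) : (0 <= nsum x)%E.
Proof. by apply: esum_ge0 => i _; rewrite lee_fin. Qed.

Lemma le_nsumD (x y : I -> V) : (nsum (x \+ y) <= nsum x + nsum y)%E.
Proof.
rewrite -esumD; last 2 first.
- by move=> i _; rewrite lee_fin.
- by move=> i _; rewrite lee_fin.
by apply: le_esum => i _; rewrite -EFinD lee_fin ler_normD.
Qed.

Lemma le_nsumZ (a : R) (x : I -> V) :
  (nsum (fun i => a *: x i) <= `|a|%:E * nsum x)%E.
Proof.
apply: ge_ereal_sup => _ [A [finA _] <-].
under eq_fsbigr do rewrite normrZ EFinM.
rewrite -ge0_mule_fsumr; last by move=> i; rewrite lee_fin.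
rewrite lee_wpmul2l ?lee_fin//.
by apply: ereal_sup_ubound; exists A.
Qed.

Lemma norm_summable_submod_closed : submod_closed norm_summable.
Proof.
split.
  by rewrite /norm_summable unfold_in esum1 ?ltry// => i _; rewrite normr0.
move=> a x y xoo yoo; rewrite /norm_summable unfold_in.
apply: le_lt_trans (le_nsumD (fun i => a *: x i) y) _.
rewrite lte_add_pinfty//; apply: le_lt_trans (le_nsumZ a x) _.
by rewrite lte_mul_pinfty// lee_fin.
Qed.

HB.instance Definition _ := GRing.isSubmodClosed.Build R (I -> V) norm_summable
  norm_summable_submod_closed.

(* The sum of the norms is unordered (a supremum over finite subsets of I), so
   that I may be uncountable. *)
Record ell1_sum := Ell1Sum {
  ell1_sum_family :> I -> V;
  ell1_sumP : ell1_sum_family \in norm_summable }.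

HB.instance Definition _ := [isSub for ell1_sum_family].
HB.instance Definition _ := [Choice of ell1_sum by <:].
HB.instance Definition _ := [SubChoice_isSubLmodule of ell1_sum by <:].

Definition ell1_sum_norm (x : ell1_sum) : R := fine (nsum x).

Lemma ell1_sum_normK (x : ell1_sum) : (ell1_sum_norm x)%:E = nsum x.
Proof.
apply: fineK; rewrite ge0_fin_numE ?nsum_ge0//; exact: ell1_sumP.
Qed.

Lemma ler_ell1_sum_normD (x y : ell1_sum) :
  ell1_sum_norm (x + y) <= ell1_sum_norm x + ell1_sum_norm y.
Proof. by rewrite -lee_fin EFinD !ell1_sum_normK; exact: le_nsumD. Qed.

Lemma ell1_sum_normZ (a : R) (x : ell1_sum) :
  ell1_sum_norm (a *: x) = `|a| * ell1_sum_norm x.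
Proof.
have leZ b y : ell1_sum_norm (b *: y) <= `|b| * ell1_sum_norm y.
  by rewrite -lee_fin EFinM !ell1_sum_normK; exact: le_nsumZ.
apply/eqP; rewrite eq_le leZ/=.
have [->|a0] := eqVneq a 0.
  by rewrite normr0 mul0r fine_ge0// nsum_ge0.
rewrite mulrC -ler_pdivlMr ?normr_gt0// mulrC -normfV.
by rewrite -[X in ell1_sum_norm X <= _](scalerK a0) leZ.
Qed.

Lemma ell1_sum_norm0_eq0 (x : ell1_sum) : ell1_sum_norm x = 0 -> x = 0.
Proof.
move=> x0; apply/val_inj/funext => i; apply/eqP.
rewrite -normr_le0 -lee_fin -x0 ell1_sum_normK.
apply: esum_ge; exists [set i]; first by split.
by rewrite fsbig_set1.
Qed.

HB.instance Definition _ := Lmodule_isNormed.Build R ell1_sum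
  ler_ell1_sum_normD ell1_sum_normZ ell1_sum_norm0_eq0.

Lemma ell1_sum_normE (x : ell1_sum) :
  `|x| = fine (\esum_(i in [set: I]) `|x i|%:E)%E.
Proof. by []. Qed.

End ell1_sum.

(* Main.v *)
(* There are countably many "codes" c: a level n of the binary tree and a map
   from its nodes to pairs of a coordinate and a sign. Each code gives the
   functional x |-> \sum_t sign_c(t | n) * x_t (coord_c(t | n)), of norm at most
   1 on the l1-sum, and listing all these functionals gives the embedding.
   It is isometric: finitely many branches are separated at some level, so for
   every finite set of indices t some functional almost norms all the
   corresponding x_t simultaneously, and these x_t carry almost all of the norm
   of x. *)
From HB Require Import structures.
Require Import Defs.
From mathcomp Require Import all_boot all_order all_algebra.
From mathcomp Require Import all_classical all_reals all_analysis.
Import numFieldNormedType.Exports.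
Local Open Scope ring_scope.
From mathcomp Require Import ring.
Set Implicit Arguments.
Unset Strict Implicit.
Unset Printing Implicit Defensive.
Import Order.TTheory GRing.Theory Num.Theory.
Local Open Scope classical_set_scope.

(** * Unordered sums of real families over an arbitrary index type *)

Section unordered_sum.
Variables (R : realType) (I : choiceType).
Implicit Types (u v a b : I -> R) (s : seq I).

Definition nnsummable u :=
  (forall i, 0 <= u i) /\ (\esum_(i in [set: I]) (u i)%:E < +oo)%E.

(** [fine] sends an infinite sum to 0, so the value is meaningful only under [nnsummable]. *)
Definition nnsum u : R := fine (\esum_(i in [set: I]) (u i)%:E)%E.

Lemma nnsumK u : nnsummable u -> (nnsum u)%:E = \esum_(i in [set: I]) (u i)%:E.
Proof.
move=> [u0 uoo]; rewrite fineK// ge0_fin_numE//.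
by apply: esum_ge0 => i _; rewrite lee_fin.
Qed.

Lemma esum_le_fin u (M : R) :
  (forall s, uniq s -> \sum_(i <- s) u i <= M) ->
  (\esum_(i in [set: I]) (u i)%:E <= M%:E)%E.
Proof.
move=> uM; apply: ge_ereal_sup => _ [A [finA _] <-].
by rewrite fsbig_finite//= sumEFin lee_fin uM.
Qed.

Lemma sum_le_nnsum u s : nnsummable u -> uniq s ->
  \sum_(i <- s) u i <= nnsum u.
Proof.
move=> us uniqs; rewrite -lee_fin nnsumK// -sumEFin fsbig_seq//.
by apply: esum_ge; exists [set` s] => //; split=> //; exact: finite_seq.
Qed.

Lemma nnsum_le u (M : R) : (forall i, 0 <= u i) ->
  (forall s, uniq s -> \sum_(i <- s) u i <= M) ->
  nnsummable u /\ nnsum u <= M.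
Proof.
move=> u0 uM; have us : nnsummable u.
  by split=> //; apply: le_lt_trans (esum_le_fin uM) (ltry _).
by split=> //; rewrite -lee_fin nnsumK//; exact: esum_le_fin.
Qed.

Lemma le_nnsummable u v : (forall i, 0 <= u i <= v i) -> nnsummable v ->
  nnsummable u /\ nnsum u <= nnsum v.
Proof.
move=> uv vs; apply: nnsum_le => [i|s us]; first by case/andP: (uv i).
apply: le_trans (sum_le_nnsum vs us).
by apply: ler_sum => i _; case/andP: (uv i).
Qed.

Lemma nnsumD u v : nnsummable u -> nnsummable v ->
  nnsummable (u \+ v) /\ nnsum (u \+ v) = nnsum u + nnsum v.
Proof.
move=> us vs; have [u0 uoo] := us; have [v0 voo] := vs.
have E : (\esum_(i in [set: I]) ((u \+ v) i)%:E = (nnsum u + nnsum v)%:E)%E.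
  rewrite EFinD !nnsumK// -esumD//; first by move=> i _; rewrite lee_fin.
  by move=> i _; rewrite lee_fin.
split; last by rewrite {1}/nnsum E.
by split=> [i|]; rewrite ?E ?ltry// addr_ge0.
Qed.

Lemma nnsumZ (c : R) u : 0 <= c -> nnsummable u ->
  nnsummable (fun i => c * u i) /\ nnsum (fun i => c * u i) = c * nnsum u.
Proof.
have leZ d v : 0 <= d -> nnsummable v ->
    nnsummable (fun i => d * v i) /\ nnsum (fun i => d * v i) <= d * nnsum v.
  move=> d0 vs; apply: nnsum_le => [i|s us].
    by rewrite mulr_ge0//; case: vs.
  by rewrite -mulr_sumr ler_wpM2l// sum_le_nnsum.
move=> c0 us; have [cus cule] := leZ _ _ c0 us; split=> //.
apply/eqP; rewrite eq_le cule/=.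
have [c00|cn0] := eqVneq c 0.
  by rewrite c00 mul0r fine_ge0// esum_ge0// => i _; rewrite mul0r.
(* The reverse inequality is the one just proved, applied to [c^-1] and the family [c * u i]. *)
have [_] := leZ c^-1 _ (eqbRL (invr_ge0 c) c0) cus.
under [X in nnsum X]eq_fun do rewrite mulKf//.
by rewrite mulrC ler_pdivlMr ?lt0r ?cn0// mulrC.
Qed.

Definition usum a : R := nnsum a^\+ - nnsum a^\-.

Definition abs_summable a := nnsummable (fun i => `|a i|).

Lemma abs_summable_posneg a : abs_summable a ->
  nnsummable a^\+ /\ nnsummable a^\-.
Proof.
move=> aoo; split.
  have [] // := @le_nnsummable a^\+ _ _ aoo => i.
  by rewrite funrpos_ge0/= /funrpos ge_max normr_ge0 ler_norm.
have [] // := @le_nnsummable a^\- _ _ aoo => i.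
by rewrite funrneg_ge0/= /funrneg ge_max normr_ge0 -normrN ler_norm.
Qed.

(** From [a^\+ - a^\- = u - v] follows [a^\+ + v = u + a^\-], an identity between nonnegative
    families, on which [nnsum] is additive. *)
Lemma usumB a u v : nnsummable u -> nnsummable v -> a =1 u \- v ->
  usum a = nnsum u - nnsum v.
Proof.
move=> us vs auv; have [u0 _] := us; have [v0 _] := vs.
have [uvs _] := nnsumD us vs.
have [] := @le_nnsummable (fun i => `|a i|) _ _ uvs => [i|aoo _].
  by rewrite normr_ge0 auv/= (le_trans (ler_normB _ _))// !ger0_norm.
have [ap an] := abs_summable_posneg aoo.
apply/eqP; rewrite subr_eq addrAC eq_sym subr_eq.
rewrite -(nnsumD us an).2 -(nnsumD ap vs).2; apply/eqP; congr nnsum.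
apply/funext => i /=; have := congr1 (@^~ i) (funrposBneg a).
rewrite !fctE auv /= => /eqP; rewrite subr_eq => /eqP ->.
by rewrite addrAC subrK.
Qed.

Lemma usum_linear (c : R) a b : abs_summable a -> abs_summable b ->
  usum (fun i => c * a i + b i) = c * usum a + usum b.
Proof.
move=> /abs_summable_posneg[ap an] /abs_summable_posneg[bp bn].
have aE i : a i = a^\+ i - a^\- i by rewrite -[in LHS](funrposBneg a).
have bE i : b i = b^\+ i - b^\- i by rewrite -[in LHS](funrposBneg b).
have [c0|c0] := leP 0 c.
  have [cap capE] := nnsumZ c0 ap; have [can canE] := nnsumZ c0 an.
  have [ps pE] := nnsumD cap bp; have [ns nE] := nnsumD can bn.
  rewrite (usumB ps ns); last by move=> i; rewrite /= aE bE; ring.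
  by rewrite pE nE capE canE /usum; ring.
(* A negative scalar swaps the two parts: the decomposition is [(- c * a^\- + b^\+) - (- c * a^\+ +
   b^\-)]. *)
have Nc0 : 0 <= - c by rewrite oppr_ge0 ltW.
have [cap capE] := nnsumZ Nc0 ap; have [can canE] := nnsumZ Nc0 an.
have [ps pE] := nnsumD can bp; have [ns nE] := nnsumD cap bn.
rewrite (usumB ps ns); last by move=> i; rewrite /= aE bE; ring.
by rewrite pE nE capE canE /usum; ring.
Qed.

Lemma normr_usum a : abs_summable a -> `|usum a| <= nnsum (fun i => `|a i|).
Proof.
move=> aoo; have [ap an] := abs_summable_posneg aoo.
have -> : (fun i => `|a i|) = a^\+ \+ a^\-.
  by apply/funext => i; have := congr1 (@^~ i) (funrposDneg a).
rewrite (nnsumD ap an).2 (le_trans (ler_normB _ _))//.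
by rewrite !ger0_norm// fine_ge0// esum_ge0// => i _; rewrite lee_fin.
Qed.

(* Adding [v] turns a signed sum into a sum of nonnegative terms, so that the
   terms outside of [s] can be discarded. *)
Lemma sum_le_usum a v s : nnsummable v -> (forall i, `|a i| <= v i) ->
  uniq s -> \sum_(i <- s) (a i + v i) <= usum a + nnsum v.
Proof.
move=> vs av us; have [v0 _] := vs; have [vvs _] := nnsumD vs vs.
have avs : nnsummable (a \+ v).
  have [] // := @le_nnsummable (a \+ v) _ _ vvs => i /=.
  by move: (av i); rewrite ler_norml lerD2r -lerBlDr sub0r.
rewrite (@usumB a _ _ avs vs) ?subrK; first exact: sum_le_nnsum.
by move=> i; rewrite /= addrK.
Qed.

End unordered_sum.

(** * Finite-level codes on the binary tree *)

Section embedding.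
Variable R : realType.
Local Notation cantor := (nat -> bool).
Local Notation X := (ell1_sum cantor (ell_infty R)).

Definition restr n (t : cantor) : {ffun 'I_n -> bool} := [ffun i : 'I_n => t i].

Lemma restr_separates (s : seq cantor) :
  exists n, {in s &, injective (restr n)}.
Proof.
have dP (p : cantor * cantor) : exists k, p.1 <> p.2 -> p.1 k <> p.2 k.
  have [tt'|/existsNP[k tt'k]] := pselect (forall k, p.1 k = p.2 k).
    by exists 0%N => -[]; exact/funext.
  by exists k.
have [d {}dP] := choice dP.
(* [d] gives a position where two distinct branches differ; this level lies beyond all such
   positions for pairs from [s]. *)
exists (\max_(t <- s) \max_(t' <- s) (d (t, t')).+1)%N => t t' ts t's.
move=> /ffunP tt'; apply: contrapT => /(dP (t, t'))/=; apply.
have dlt : (d (t, t') < \max_(t <- s) \max_(t' <- s) (d (t, t')).+1)%N.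
  apply: leq_trans (leq_bigmax_seq _ ts isT).
  exact: (leq_trans _ (leq_bigmax_seq _ t's isT)).
by have := tt' (Ordinal dlt); rewrite !ffunE.
Qed.

(* A code is a map on the nodes of some level n of the binary tree: a branch t
   is sent to a coordinate and a sign that depend on its first n bits only. *)
Definition code := {n : nat & {ffun {ffun 'I_n -> bool} -> nat * bool}}.

Definition code_at (c : code) (t : cantor) : nat * bool :=
  tagged c (restr (tag c) t).

(** At a level that separates [s], at most one branch of [s] passes through each node, so the node
    determines the value of [g] there. *)
Lemma code_interpolation (s : seq cantor) (g : cantor -> nat * bool) :
  exists c, {in s, code_at c =1 g}.
Proof.
have [n inj] := restr_separates s.
(* [pre w] is a branch of [s] through the node [w]; the default is reached only at nodes that [s]
   misses. *)
pose pre w := xget (fun=> false) [set t : cantor | t \in s /\ restr n t = w].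
exists (existT _ n [ffun w => g (pre w)]) => t ts.
rewrite /code_at/= ffunE; congr g.
have [//|ps pE] := @xgetPex _ (fun=> false)
  [set t' : cantor | t' \in s /\ restr n t' = restr n t]; first by exists t.
exact: inj.
Qed.

(** * The functional attached to a code *)

Definition code_term (c : code) (x : X) (t : cantor) : R :=
  (-1) ^+ (code_at c t).2 * x t (code_at c t).1.

Lemma nnsummable_norm (x : X) : nnsummable (fun t => `|x t|).
Proof. by split=> [t|]; [exact: normr_ge0|exact: (ell1_sumP x)]. Qed.

Lemma ler_code_term (c : code) (x : X) t : `|code_term c x t| <= `|x t|.
Proof. by rewrite normrMsign; exact: ell_infty_norm_ubound. Qed.

Lemma code_term_summable (c : code) (x : X) :
  abs_summable (code_term c x) /\ nnsum (fun t => `|code_term c x t|) <= `|x|.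
Proof.
apply: (le_nnsummable _ (nnsummable_norm x)) => t.
by rewrite normr_ge0 ler_code_term.
Qed.

Definition code_functional (c : code) (x : X) : R := usum (code_term c x).

Lemma code_functional_linear c (k : R) (x y : X) :
  code_functional c (k *: x + y) = k * code_functional c x + code_functional c y.
Proof.
rewrite -usum_linear; [|exact: (code_term_summable _ _).1..].
congr usum; apply/funext => t; rewrite /code_term.
have -> n : (k *: x + y) t n = k * x t n + y t n by [].
by rewrite mulrDr mulrCA.
Qed.

Lemma code_functional_le c x : `|code_functional c x| <= `|x|.
Proof.
have [xs xle] := code_term_summable c x.
exact: le_trans (normr_usum xs) xle.
Qed.

(** * The functionals determine the norm *)

Lemma almost_norming (r : R) (y : ell_infty R) : r < 1 ->
  exists p : nat * bool, r * `|y| <= (-1) ^+ p.2 * y p.1.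
Proof.
move=> r1; apply: contrapT => /forallNP yP.
have ylt n : `|y n| < r * `|y|.
  (* The sign bit [y n < 0] turns [y n] into its absolute value. *)
  rewrite ltNge; apply/negP => le; apply: (yP (n, y n < 0)) => /=.
  by rewrite -normrEsign.
have : `|y| <= r * `|y| by apply: ell_infty_norm_le => n; exact: ltW.
rewrite leNgt => /negP; apply; rewrite gtr_pMl// normr_gt0.
apply/eqP => y0; have := le_lt_trans (normr_ge0 _) (ylt 0%N).
by rewrite y0 normr0 mulr0 ltxx.
Qed.

(** For [r < 1] and finite [s], a code norming each [x t] with [t] in [s] up to the factor [r] shows
    that [(r + 1)] times the sum of the norms over [s] is at most [M + |x|]. The supremum over [s]
    gives [r * |x| <= M], and [r] is arbitrarily close to 1. *)
Lemma norm_le_functional (x : X) (M : R) :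
  (forall c, `|code_functional c x| <= M) -> `|x| <= M.
Proof.
move=> xM; have [xs x0] := (nnsummable_norm x, normr_ge0 x).
have M0 : 0 <= M := le_trans (normr_ge0 _) (xM (existT _ 0%N [ffun=> (0%N, true)])).
suff rM r : 0 < r -> r < 1 -> r * `|x| <= M.
  rewrite leNgt; apply/negP => Mx.
  have x_gt0 := le_lt_trans M0 Mx.
  (* This [r] makes [r * |x|] the midpoint of [M] and [|x|], which exceeds [M]. *)
  have := rM ((M + `|x|) / 2 / `|x|).
  rewrite divfK ?gt_eqF// ltr_pdivrMr// mul1r.
  rewrite !divr_gt0// ?ltr_wpDl// => /(_ isT).
  by rewrite midf_lt// => /(_ isT); rewrite leNgt midf_lt.
move=> r0 r1; have r10 : 0 < r + 1 by rewrite ltr_wpDl// ltW.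
have [g gP] := choice (fun t => almost_norming (x t) r1).
suff : `|x| <= (M + `|x|) / (r + 1).
  by rewrite ler_pdivlMr// mulrDr mulr1 lerD2r mulrC.
apply: (nnsum_le xs.1 _).2 => s us.
have [c cE] := code_interpolation s g.
rewrite ler_pdivlMr// mulr_suml.
have := sum_le_usum xs (ler_code_term c x) us.
move=> /le_trans/(_ (lerD (le_trans (ler_norm _) (xM c)) (lexx _))).
apply: le_trans; rewrite big_seq [leRHS]big_seq; apply: ler_sum => t ts.
by rewrite mulrDr mulr1 lerD2r mulrC /code_term cE.
Qed.

(** * The isometric embedding, with coordinates indexed through the countability of codes *)

Definition embedding_seq (x : X) (k : nat) : R :=
  if unpickle k is Some c then code_functional c x else 0.

Lemma embedding_seq_le x k : `|embedding_seq x k| <= `|x|.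
Proof.
rewrite /embedding_seq; case: unpickle => [c|]; first exact: code_functional_le.
by rewrite normr0.
Qed.

Lemma embedding_seq_bounded x : embedding_seq x \in @bounded_seq R.
Proof. by apply/bounded_seqP; exists `|x| => k; exact: embedding_seq_le. Qed.

Definition embedding (x : X) : ell_infty R :=
  EllInfty (embedding_seq_bounded x).

Lemma embedding_is_linear : linear embedding.
Proof.
move=> k x y; apply/val_inj/funext => m /=.
rewrite /embedding_seq !fctE /=; case: unpickle => [c|].
  exact: code_functional_linear.
by rewrite scaler0 addr0.
Qed.

HB.instance Definition _ :=
  GRing.isLinear.Build R X (ell_infty R) _ embedding embedding_is_linear.

Lemma norm_embedding x : `|embedding x| = `|x|.
Proof.
apply/eqP; rewrite eq_le; apply/andP; split.
  by apply: ell_infty_norm_le => k; exact: embedding_seq_le.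
apply: norm_le_functional => c.
(* Every functional occurs as a coordinate, at index [pickle c]. *)
have := ell_infty_norm_ubound (embedding x) (pickle c).
by rewrite /= /embedding_seq pickleK.
Qed.

End embedding.

Theorem proposition24 (R : realType) :
  exists T : {linear ell1_sum (nat -> bool) (ell_infty R) -> ell_infty R},
    forall x : ell1_sum (nat -> bool) (ell_infty R), `|T x| = `|x|.
Proof. by exists (@embedding R) => x; exact: norm_embedding. Qed.
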